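(* If a ring $R$ is a right H-ring and a right max-ring, then $R$ is right strongly dual Kasch. In particular, any commutative perfect ring is strongly dual Kasch.
   Context: Rings are associative, unital and non-trivial; modules are unital right modules, and $E(M)$ denotes the injective hull of $M$. A ring $R$ is a right H-ring if $\mathrm{Hom}_R(E(S),E(T))=0$ for any non-isomorphic simple right $R$-modules $S,T$. A right max-ring is a ring such that every non-zero right module contains a maximal submodule. A ring $R$ is right strongly dual Kasch if every simple right $R$-module $S$ is a homomorphic image of its injective hull $E(S)$; for commutative $R$ the word ''right'' is dropped. *)

(* Defs.v *)
From HB Require Import structures.
From mathcomp Require Import all_boot all_order all_algebra.

Set Implicit Arguments.
Unset Strict Implicit.
Unset Printing Implicit Defensive.

Import GRing.Theory.
Local Open Scope ring_scope.

(* Right R-modules are left modules over the converse ring R^c.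
   Submodules are boolean predicates closed under the module operations;
   with the classical axioms of MathComp-Analysis these are the same as
   arbitrary (Prop-valued) submodules. *)
Notation rmodType R := (lmodType R^c).

Section Modules.
Variable R : nzRingType.
Implicit Types M N E P S T : rmodType R.

Definition nonzero_module M : Prop := exists x : M, x != 0.

Definition simple_module S : Prop :=
  nonzero_module S /\
  forall N : {pred S}, GRing.submod_closed N ->
    (forall x, x \in N -> x = 0) \/ (forall x, x \in N).

Definition isomorphic_modules M N : Prop :=
  exists f : {linear M -> N}, bijective f.

Definition surjective_map (A B : Type) (f : A -> B) : Prop :=
  forall y, exists x, f x = y.

Definition maximal_submodule M (N : {pred M}) : Prop :=
  [/\ GRing.submod_closed N,
      exists x, x \notin N
    & forall K : {pred M}, GRing.submod_closed K -> {subset N <= K} ->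
        {subset K <= N} \/ (forall x, x \in K)].

Definition injective_module E : Prop :=
  forall (A B : rmodType R) (i : {linear A -> B}) (g : {linear A -> E}),
    injective i -> exists h : {linear B -> E}, h \o i =1 g.

Definition essential_mono M E (i : {linear M -> E}) : Prop :=
  injective i /\
  forall N : {pred E}, GRing.submod_closed N ->
    (exists2 x, x \in N & x != 0) -> exists2 m : M, i m \in N & i m != 0.

(* E(M) is unique up to isomorphism over M; the notions below quantify over
   all of its realizations (E, i). *)
Definition injective_hull M E (i : {linear M -> E}) : Prop :=
  injective_module E /\ essential_mono i.

Definition projective_module P : Prop :=
  forall (A B : rmodType R) (q : {linear A -> B}) (g : {linear P -> B}),
    surjective_map q -> exists h : {linear P -> A}, q \o h =1 g.

Definition superfluous M (K : {pred M}) : Prop :=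
  forall N : {pred M}, GRing.submod_closed N ->
    (forall x, exists y z, [/\ y \in N, z \in K & x = y + z]) ->
    forall x, x \in N.

Definition projective_cover M P (p : {linear P -> M}) : Prop :=
  [/\ projective_module P, surjective_map p
    & superfluous [pred x | p x == 0]].

End Modules.

Definition right_H_ring (R : nzRingType) : Prop :=
  forall (S T ES ET : rmodType R) (i : {linear S -> ES}) (j : {linear T -> ET}),
    simple_module S -> simple_module T -> ~ isomorphic_modules S T ->
    injective_hull i -> injective_hull j ->
    forall (f : {linear ES -> ET}) (x : ES), f x = 0.

Definition right_max_ring (R : nzRingType) : Prop :=
  forall M : rmodType R, nonzero_module M ->
    exists N : {pred M}, maximal_submodule N.

Definition right_strongly_dual_Kasch (R : nzRingType) : Prop :=
  forall (S E : rmodType R) (i : {linear S -> E}),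
    simple_module S -> injective_hull i ->
    exists f : {linear E -> S}, surjective_map f.

(* Bass: every right module has a projective cover. *)
Definition right_perfect_ring (R : nzRingType) : Prop :=
  forall M : rmodType R,
    exists (P : rmodType R) (p : {linear P -> M}), projective_cover p.

Definition perfect_comring (R : comNzRingType) : Prop := right_perfect_ring R.

Definition strongly_dual_Kasch (R : comNzRingType) : Prop :=
  right_strongly_dual_Kasch R.

(* Main.v *)
From HB Require Import structures.
Require Import Defs.
From mathcomp Require Import all_boot all_order all_algebra.
From mathcomp Require Import boolp classical_sets functions.
From mathcomp Require Import freeg.

Set Implicit Arguments.
Unset Strict Implicit.
Unset Printing Implicit Defensive.

Import GRing.Theory Num.Theory.
Local Open Scope ring_scope.

(** First half.  Let [S] be simple with injective hull [E].  Since [R] is a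
    right max-ring, [E] has a maximal submodule [N], and [T = E / N] is
    simple.  If [T] is isomorphic to [S], then [E -> T -> S] is the required
    surjection.  Otherwise [E -> T], followed by [T -> E(T)], is a non-zero map
    [E(S) -> E(T)] between hulls of non-isomorphic simple modules, which
    contradicts the H-ring condition.

    The argument needs an injective hull of [T], and both [T] and [E(T)] are
    found inside one injective module, the character module [Hom_Z(R, Q/Z)].
    A character of the additive group of [E] that kills [N] but not all of [E]
    ([separating_character]) transposes to a linear map [E -> Hom_Z(R, Q/Z)]
    whose kernel contains [N] and is proper, hence is [N]; its image is [T]
    ([simple_quotient]).  The character module is injective because additive
    maps into the divisible group [Q/Z] extend
    ([injective_character_module]), and a maximal essential extension of [T]
    inside it is a direct summand, hence injective ([has_injective_hull]).

    Second half.  For commutative [R] there is a direct argument.  Let [m] be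
    the annihilator of a non-zero [s] in [S], so that [R / m] is a field.  If
    [E m] is not [E], some linear map sends a non-zero vector of the
    [R / m]-space [E / E m] to [s], which gives a non-zero, hence surjective,
    map [E -> S] ([linear_to_simple_extending]).  If [E m = E], let [P -> E] be a projective
    cover.  Then [P m] and the superfluous kernel span [P], so [P m = P].
    Projectivity gives [P] coordinates in a free module, all of them in [m],
    and the determinant trick shows that each element of [P] is killed by some
    [1 - a] with [a] in [m] ([projective_ideal_span_annihilated]).  The same
    then holds for each element of [E], in particular for [s], which is also
    killed by [a]; so [s = 0], a contradiction. *)

(** * Maximal submodules and extension of partial linear maps *)

Section Submodules.
Variables (K : nzRingType) (M : lmodType K).
Implicit Types G H N : {pred M}.

Lemma submodD G x y : GRing.submod_closed G -> x \in G -> y \in G -> x + y \in G.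
Proof. by case=> _ GL Gx Gy; rewrite -[x]scale1r GL. Qed.

Lemma submodZ G a x : GRing.submod_closed G -> x \in G -> a *: x \in G.
Proof. by case=> G0 GL Gx; rewrite -[a *: x]addr0 GL. Qed.

Lemma submodN G x : GRing.submod_closed G -> x \in G -> - x \in G.
Proof. by move=> GS Gx; rewrite -scaleN1r submodZ. Qed.

Lemma submodB G x y : GRing.submod_closed G -> x \in G -> y \in G -> x - y \in G.
Proof. by move=> GS Gx Gy; rewrite submodD // submodN. Qed.

Definition mkpred (P : M -> Prop) : {pred M} := [pred x | `[< P x >]].

Definition sum_with_line G (x : M) : {pred M} :=
  mkpred (fun y => exists2 g, g \in G & exists a, y = g + a *: x).

Lemma sum_with_line_closed G x :
  GRing.submod_closed G -> GRing.submod_closed (sum_with_line G x).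
Proof.
move=> GS; split.
  by apply/asboolP; exists 0; [case: GS | exists 0; rewrite scale0r addr0].
move=> a _ _ /asboolP[g Gg [b ->]] /asboolP[h Gh [c ->]]; apply/asboolP.
exists (a *: g + h); first by case: GS => _; apply.
by exists (a * b + c); rewrite scalerDr scalerDl scalerA addrACA.
Qed.

Lemma sub_sum_with_line G x : {subset G <= sum_with_line G x}.
Proof.
by move=> g Gg; apply/asboolP; exists g => //; exists 0; rewrite scale0r addr0.
Qed.

Lemma mem_sum_with_line G x : GRing.submod_closed G -> x \in sum_with_line G x.
Proof.
move=> [G0 _]; apply/asboolP; exists 0 => //.
by exists 1; rewrite scale1r add0r.
Qed.

(** Essentiality over a fixed submodule, meeting a fixed submodule trivially
    and being the graph of a partial function are all conditions on the
    individual elements of a submodule, and such conditions pass to unions of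
    chains.  This one form of Zorn's lemma therefore serves every maximality
    argument below. *)
Lemma maximal_submodule_within (q : M -> Prop) G0 :
  GRing.submod_closed G0 -> (forall x, x \in G0 -> q x) ->
  exists G, [/\ GRing.submod_closed G, {subset G0 <= G},
                forall x, x \in G -> q x
              & forall H, GRing.submod_closed H -> {subset G <= H} ->
                  (forall x, x \in H -> q x) -> {subset H <= G}].
Proof.
move=> G0S G0q.
pose good (A : set M) := [/\ GRing.submod_closed (mkpred A),
  (forall x, x \in G0 -> A x) & (forall x, A x -> q x)].
(* The empty set is let in so that the empty chain has an upper bound. *)
pose P (A : set M) := A = set0 \/ good A.
have goodG (H : {pred M}) : GRing.submod_closed H -> {subset G0 <= H} ->
    (forall x, x \in H -> q x) -> good (fun x => x \in H).
  move=> HS sH Hq; split=> //.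
  suff -> : mkpred (fun x => x \in H) = H by [].
  by apply: boolp.funext => x; rewrite /mkpred /= asboolb.
have [F FP Ftot|A [PA Amax]] := @Zorn_bigcup M P.
  have [[A FA [x Ax]]|F0] := pselect (exists2 A, F A & exists x, A x); last first.
    left; apply/seteqP; split=> // x [A FA Ax].
    by apply: F0; exists A => //; exists x.
  have [] := FP A FA => [A0|[AS sA _]]; first by rewrite A0 in Ax.
  right; split.
  - split; first by apply/asboolP; exists A => //; apply: sA; case: G0S.
    move=> a u v /asboolP[B FB Bu] /asboolP[C FC Cv]; apply/asboolP.
    have lin D : F D -> D u -> D v -> D (a *: u + v).
      move=> FD Du Dv; case: (FP D FD) => [D0|[[_ DL] _ _]].
        by rewrite D0 in Du.
      by apply/asboolP/DL; apply/asboolP.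
    have [BC|CB] := Ftot B C FB FC.
      by exists C => //; apply: lin => //; apply: BC.
    by exists B => //; apply: lin => //; apply: CB.
  - by move=> z /sA; exists A.
  - move=> z [B FB Bz]; case: (FP B FB) => [B0|[_ _]]; last exact.
    by rewrite B0 in Bz.
have {PA} [A0|[AS sA qA]] := PA.
  case: (Amax (fun x => x \in G0)); last by right; apply: goodG.
  rewrite A0; split; first by [].
  by move=> /(_ 0 (proj1 G0S)).
exists (mkpred A); split=> //.
- by move=> x /sA Ax; apply/asboolP.
- by move=> x /asboolP; apply: qA.
- move=> H HS sAH Hq x Hx; apply/asboolP; apply: contrapT => nAx.
  apply: (Amax (fun x => x \in H)).
    by split=> [y Ay|/(_ x Hx)//]; apply/sAH/asboolP.
  by right; apply: goodG => // z /sA Az; apply/sAH/asboolP.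
Qed.

End Submodules.

(** A partial linear map is a submodule of [M * N] that contains no [(0, y)]
    with [y != 0].  A value [d] is admissible at [b] when it agrees with the
    value already forced on every multiple of [b] in the domain; if each [b]
    has an admissible value, then a maximal partial map is defined
    everywhere. *)
Lemma extend_partial_linear (K : nzRingType) (M N : lmodType K)
    (G0 : {pred M * N}) :
  GRing.submod_closed G0 -> (forall y, (0, y) \in G0 -> y = 0) ->
  (forall G : {pred M * N}, GRing.submod_closed G -> {subset G0 <= G} ->
     (forall y, (0, y) \in G -> y = 0) ->
     forall b, exists d, forall a y, (a *: b, y) \in G -> y = a *: d) ->
  exists h : {linear M -> N}, forall x y, (x, y) \in G0 -> h x = y.
Proof.
move=> G0S G0f step.
have [[x y] /= xyG0 x0|G [GS sG Gf Gmax]] :=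
    maximal_submodule_within (q := fun z => z.1 = 0 -> z.2 = 0) G0S.
  by apply: G0f; rewrite -x0.
have Gf0 y : (0, y) \in G -> y = 0 by move/Gf; apply.
have dom b : exists d, (b, d) \in G.
  have [d dP] := step G GS sG Gf0 b; exists d.
  apply: (Gmax _ (sum_with_line_closed (b, d) GS)).
  - exact: sub_sum_with_line.
  - move=> _ /asboolP[[x y] Gxy [a ->]] /= /eqP; rewrite addr_eq0 => /eqP xE.
    apply/eqP; rewrite addr_eq0; apply/eqP.
    rewrite -scaleNr; apply: dP; rewrite scaleNr -xE; exact: Gxy.
  - exact: mem_sum_with_line.
have Gfun x y z : (x, y) \in G -> (x, z) \in G -> y = z.
  move=> Gy Gz; apply/eqP; rewrite -subr_eq0; apply/eqP/Gf0.
  have -> : (0, y - z) = (x, y) - (x, z) :> M * N by congr pair; rewrite /= subrr.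
  exact: submodB.
have [h hP] := choice dom.
have hlin : linear h.
  move=> a u v; apply: (Gfun (a *: u + v)); first exact: hP.
  have -> : (a *: u + v, a *: h u + h v) = a *: (u, h u) + (v, h v) by [].
  by case: GS => _; apply.
pose mh := GRing.isLinear.Build _ _ _ _ h hlin.
pose hL : {linear M -> N} := HB.pack h mh.
by exists hL => x y /sG Gxy; apply: (Gfun x) => //; apply: hP.
Qed.

(** * Characters of abelian groups *)

Definition integral_rat : {pred rat} := [pred x : rat | x \is a Num.int].

Fact integral_rat_zmod_closed : zmod_closed integral_rat.
Proof. by split=> [|x y xZ yZ]; rewrite inE ?rpred0 // rpredB. Qed.

HB.instance Definition _ :=
  GRing.isZmodClosed.Build rat integral_rat integral_rat_zmod_closed.

Definition QZ : zmodType := {ideal_quot integral_rat}.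

Definition toQZ (x : rat) : QZ := \pi_QZ%qT x.

Lemma toQZMn x n : toQZ (x *+ n) = toQZ x *+ n.
Proof. exact: (raddfMn (\pi_{ideal_quot integral_rat}%qT)). Qed.

Lemma toQZ_eq0 x : (toQZ x == 0) = (x \is a Num.int).
Proof.
have := Quotient.idealrBE integral_rat x 0.
rewrite subr0 inE => ->.
by rewrite /toQZ; congr (_ == _); rewrite (raddf0 (\pi_{ideal_quot integral_rat}%qT)).
Qed.

Lemma QZ_divisible n (d : QZ) : (0 < n)%N -> exists e, e *+ n = d.
Proof.
move=> n0; exists (toQZ (repr d / n%:R)); rewrite -toQZMn.
have -> : (repr d / n%:R) *+ n = repr d :> rat.
  by rewrite -[LHS]mulr_natr divfK // pnatr_eq0 -lt0n.
exact: reprK.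
Qed.

Lemma QZ_torsion n : (1 < n)%N -> exists2 d : QZ, d != 0 & d *+ n = 0.
Proof.
move=> n1; have n0 : n%:R != 0 :> rat by rewrite pnatr_eq0 -lt0n ltnW.
exists (toQZ n%:R^-1); last first.
  by apply/eqP; rewrite -toQZMn toQZ_eq0 -[_ *+ n]mulr_natr mulVf.
rewrite toQZ_eq0; apply/negP => /intrP[z zE].
have /eqP : n%:R * n%:R^-1 = 1 :> rat by rewrite mulfV.
rewrite zE -[n%:R]/(n%:~R) -intrM -[1]/(1%:~R) eqr_int => /eqP.
move=> /(congr1 absz); rewrite abszM /= => /eqP; rewrite muln_eq1.
by case/andP=> /eqP n_1; rewrite n_1 in n1.
Qed.

Lemma least_positive (P : nat -> Prop) :
  (exists2 n, (0 < n)%N & P n) ->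
  exists n, [/\ (0 < n)%N, P n & forall k, (0 < k)%N -> P k -> (n <= k)%N].
Proof.
pose p n := (0 < n)%N && `[< P n >].
case=> m m0 Pm; have e : exists n, p n.
  by exists m; rewrite /p m0; apply/asboolP.
exists (ex_minn e); case: ex_minnP => n /andP[n0 /asboolP Pn] nmin.
by split=> // k k0 Pk; apply: nmin; rewrite /p k0; apply/asboolP.
Qed.

(** The multiples of [b] that lie in the domain of a partial map are those by
    the multiples of a single [n]; if [n > 0], dividing by [n] the value at
    [n b] gives an admissible value at [b], and if [n = 0] any value will do. *)
Lemma extend_partial_into_divisible (B D : lmodType int) (G0 : {pred B * D}) :
  (forall n (d : D), (0 < n)%N -> exists e, n%:Z *: e = d) ->
  GRing.submod_closed G0 -> (forall y, (0, y) \in G0 -> y = 0) ->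
  exists h : {linear B -> D}, forall x y, (x, y) \in G0 -> h x = y.
Proof.
move=> divD G0S G0f; apply: extend_partial_linear => // G GS _ Gf b.
have [/least_positive|nodom] :=
    pselect (exists2 n, (0 < n)%N & exists y, (n%:Z *: b, y) \in G).
  move=> [n [n0 [y Gy] nmin]]; have [d dE] := divD n y n0.
  exists d => a z Gz; have aE := divz_eq a n.
  have Gr : ((a %% n)%Z *: b, z - (a %/ n)%Z *: y) \in G.
    have -> : ((a %% n)%Z *: b, z - (a %/ n)%Z *: y) =
              (a *: b, z) - (a %/ n)%Z *: (n%:Z *: b, y).
      congr pair; rewrite -[RHS]/(a *: b - (a %/ n)%Z *: (n%:Z *: b)).
      by rewrite scalerA -scalerBl [X in X - _]aE addrAC subrr add0r.
    by apply: submodB => //; apply: submodZ.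
  have r0 : (a %% n)%Z = 0.
    have: (0 <= (a %% n)%Z) by rewrite modz_ge0 // -lt0n.
    have: ((a %% n)%Z < n) by rewrite ltz_pmod.
    case: (a %% n)%Z Gr => [[|k]|k] // Gr kn _.
    have /nmin : exists y, (k.+1%:Z *: b, y) \in G by eexists; exact: Gr.
    by move=> /(_ isT); rewrite leqNgt => /negP[].
  rewrite r0 scale0r in Gr; have /eqP := Gf _ Gr.
  by rewrite subr_eq0 => /eqP ->; rewrite [in RHS]aE r0 addr0 -dE scalerA.
exists 0 => a y Gay; rewrite scaler0.
suff a0 : a = 0 by rewrite a0 scale0r in Gay; apply: Gf.
case: a Gay => [[|k]|k] // Gay; case: nodom; exists k.+1 => //.
  by exists y.
exists (- y); have -> : (k.+1%:Z *: b, - y) = - (Negz k *: b, y).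
  by congr pair; rewrite /= NegzE scaleNr opprK.
exact: submodN.
Qed.

Lemma zmod_closedMz (B : zmodType) (G : {pred B}) x a :
  zmod_closed G -> x \in G -> x *~ a \in G.
Proof.
move=> [G0 GB] Gx.
have GN y : y \in G -> - y \in G by move=> Gy; rewrite -[- y]add0r GB.
have GM n : x *+ n \in G.
  elim: n => [|n IH]; first by rewrite mulr0n.
  by rewrite mulrSr -[X in _ + X]opprK; apply: GB => //; apply: GN.
by case: a => n; [rewrite -pmulrn | rewrite NegzE mulrNz -pmulrn; apply: GN].
Qed.

Lemma extend_character (B : zmodType) (G0 : {pred B * QZ}) :
  zmod_closed G0 -> (forall y, (0, y) \in G0 -> y = 0) ->
  exists chi : {additive B -> QZ}, forall x y, (x, y) \in G0 -> chi x = y.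
Proof.
move=> G0Z G0f; pose Bz := zmodule B; pose Qz := zmodule QZ.
have G0S : GRing.submod_closed (G0 : {pred Bz * Qz}).
  have [G00 G0B] := G0Z; split=> // a u v Gu Gv.
  have -> : a *: u + v = (u : B * QZ) *~ a - ((v : B * QZ) *~ (-1)) :> B * QZ.
    rewrite mulrNz opprK mulr1z [_ *~ a]surjective_pairing.
    by rewrite (raddfMz fst) (raddfMz snd).
  by apply: G0B; apply: zmod_closedMz.
have [|h hP] :=
    extend_partial_into_divisible (_ : forall n (d : Qz), _) G0S G0f.
  move=> n d n0; have [e <-] := QZ_divisible d n0.
  by exists e; rewrite scalezrE.
pose mh := GRing.isZmodMorphism.Build B QZ h (raddfB h).
pose chi : {additive B -> QZ} := HB.pack (h : B -> QZ) mh.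
by exists chi.
Qed.

(** The character is first defined on the subgroup generated by [N] and [e]:
    it kills [N] and sends [e] to a non-zero element of [Q/Z] whose order
    divides the order of [e] modulo [N], where infinite order counts as [0]. *)
Lemma separating_character (B : zmodType) (N : {pred B}) (e : B) :
  zmod_closed N -> e \notin N ->
  exists2 chi : {additive B -> QZ}, (forall x, x \in N -> chi x = 0)
                                  & chi e != 0.
Proof.
move=> NZ eN; have [N0 NB] := NZ.
have NN x : x \in N -> - x \in N by move=> Nx; rewrite -[- x]add0r NB.
have NMz x a : x \in N -> x *~ a \in N by exact: zmod_closedMz.
have [d d0 dP] : exists2 d : QZ, d != 0 & forall a, e *~ a \in N -> d *~ a = 0.
  have [/least_positive|noN] :=
      pselect (exists2 n, (0 < n)%N & e *~ n%:Z \in N).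
    move=> [n [n0 Nn nmin]].
    have n1 : (1 < n)%N.
      by case: n n0 Nn {nmin} => [|[|n]] // _; rewrite (negPf eN).
    have [d d0 dn] := QZ_torsion n1; exists d => // a Na.
    have aE := divz_eq a n; have r0 : (a %% n)%Z = 0.
      have Nr : e *~ (a %% n)%Z \in N.
        have -> : (a %% n)%Z = a - n%:Z * (a %/ n)%Z.
          by rewrite [X in X - _]aE mulrC addrAC subrr add0r.
        by rewrite mulrzBr NB // mulrzA NMz.
      have: (0 <= (a %% n)%Z) by rewrite modz_ge0 // -lt0n.
      have: ((a %% n)%Z < n) by rewrite ltz_pmod.
      case: (a %% n)%Z Nr => [[|k]|k] // Nr kn _.
      by have := nmin k.+1 isT Nr; rewrite leqNgt => /negP[].
    by rewrite aE r0 addr0 mulrC mulrzA -pmulrn dn mul0rz.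
  (* No non-zero multiple of e lies in N, so any non-zero value is allowed. *)
  have [d d0 _] := QZ_torsion (isT : 1 < 2)%N; exists d => // a Na.
  suff -> : a = 0 by rewrite mulr0z.
  case: a Na => [[|k]|k] // Na; case: noN; exists k.+1 => //.
  by rewrite -[e *~ _]opprK -mulrNz -NegzE NN.
pose G0 : {pred B * QZ} := [pred u | `[< exists2 x, x \in N &
  exists a, u = (x + e *~ a, d *~ a) >]].
have [|y|chi chiP] := @extend_character B G0.
- split; first by apply/asboolP; exists 0 => //; exists 0; rewrite !mulr0z addr0.
  move=> _ _ /asboolP[x Nx [a ->]] /asboolP[y Ny [b ->]]; apply/asboolP.
  exists (x - y); first exact: NB.
  by exists (a - b); rewrite !mulrzBr; congr pair; rewrite /= opprD addrACA.
- move=> /asboolP[x Nx [a [/esym/eqP]]]; rewrite addr_eq0 => /eqP xE ->.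
  by apply: dP; rewrite -[e *~ a]opprK -xE NN.
exists chi => [x Nx|].
  by apply: chiP; apply/asboolP; exists x => //; exists 0; rewrite !mulr0z addr0.
suff -> : chi e = d by [].
by apply: chiP; apply/asboolP; exists 0 => //; exists 1; rewrite !mulr1z add0r.
Qed.

(** * The character module of a ring is injective *)

Section CharacterModule.
Variable R : nzRingType.

Definition additive_pred : {pred R -> QZ} :=
  [pred f | `[< forall x y, f (x - y) = f x - f y >]].

Fact additive_pred_zmod_closed : zmod_closed additive_pred.
Proof.
split; first by apply/asboolP => x y; rewrite subr0.
move=> f g /asboolP fB /asboolP gB; apply/asboolP => x y.
rewrite -[LHS]/(f (x - y) - g (x - y)) fB gB.
rewrite -[RHS]/((f x - g x) - (f y - g y)).
by rewrite !opprB addrACA [RHS]addrACA [- g x + _]addrC.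
Qed.

HB.instance Definition _ :=
  GRing.isZmodClosed.Build (R -> QZ) additive_pred additive_pred_zmod_closed.

(** [Hom_Z(R, Q/Z)].  Left multiplication of [R] on the argument makes it a
    right [R]-module. *)
Record character_module := Character {
  eval_char :> R -> QZ;
  _ : eval_char \in additive_pred }.

HB.instance Definition _ := [isSub for eval_char].
HB.instance Definition _ := [Choice of character_module by <:].
HB.instance Definition _ := [SubChoice_isSubZmodule of character_module by <:].

Implicit Types f g : character_module.

Lemma eval_charB f x y : f (x - y) = f x - f y.
Proof. by case: f => f /= /asboolP; apply. Qed.

Lemma eval_char0 f : f 0 = 0.
Proof. by rewrite -[0 in LHS](subrr 0) eval_charB subrr. Qed.

Lemma eval_charD f x y : f (x + y) = f x + f y.
Proof.
by rewrite -[y in LHS]opprK -[- y]add0r !eval_charB eval_char0 sub0r opprK.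
Qed.

Lemma eq_char f g : f =1 g -> f = g.
Proof. by move=> fg; apply: val_inj; apply: boolp.funext. Qed.

Fact scale_char_subproof (a : R^c) f :
  (fun x => f ((a : R) * x)) \in additive_pred.
Proof. by apply/asboolP => x y; rewrite mulrBr eval_charB. Qed.

Definition scale_char (a : R^c) f := Character (scale_char_subproof a f).

Fact scale_charA a b f : scale_char a (scale_char b f) = scale_char (a * b) f.
Proof. by apply: eq_char => x /=; rewrite mulrA. Qed.

Fact scale_char1 : left_id 1 scale_char.
Proof. by move=> f; apply: eq_char => x /=; rewrite mul1r. Qed.

Fact scale_charDr : right_distributive scale_char +%R.
Proof. by move=> a f g; apply: eq_char. Qed.

Fact scale_charDl f : {morph scale_char^~ f : a b / a + b}.
Proof. by move=> a b; apply: eq_char => x /=; rewrite mulrDl eval_charD. Qed.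

HB.instance Definition _ := GRing.Zmodule_isLmodule.Build R^c character_module
  scale_charA scale_char1 scale_charDr scale_charDl.

(** One direction of the adjunction between forgetting the [R]-action and
    [Hom_Z(R, -)]. *)
Lemma char_transpose (M : rmodType R) (chi : {additive M -> QZ}) :
  exists h : {linear M -> character_module},
    forall x (r : R), h x r = chi ((r : R^c) *: x).
Proof.
have sub x : (fun r : R => chi ((r : R^c) *: x)) \in additive_pred.
  by apply/asboolP => r s; rewrite scalerBl raddfB.
pose h x := Character (sub x).
have hL : linear h.
  move=> a x y; apply: eq_char => r /=.
  rewrite -[RHS]/(h x ((a : R) * r) + h y r) /=.
  by rewrite scalerDr raddfD scalerA.
pose mh := GRing.isLinear.Build _ _ _ _ h hL.
pose hl : {linear M -> character_module} := HB.pack h mh.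
by exists hl.
Qed.

(** By adjunction, extending a linear map [g] into [Hom_Z(R, Q/Z)] amounts to
    extending the character [a |-> g a 1]. *)
Lemma injective_character_module : injective_module character_module.
Proof.
move=> A B i g i_inj.
pose G0 : {pred B * QZ} := [pred u | `[< exists a, u = (i a, g a 1) >]].
have [|y|chi chiP] := @extend_character B G0.
- split; first by apply/asboolP; exists 0; rewrite !raddf0.
  move=> _ _ /asboolP[a ->] /asboolP[b ->]; apply/asboolP.
  by exists (a - b); rewrite !raddfB.
- move=> /asboolP[a [/esym/eqP]]; rewrite raddf_eq0 // => /eqP -> ->.
  by rewrite raddf0.
have [h hE] := char_transpose chi; exists h => a; apply: eq_char => r /=.
rewrite hE -linearZ /= (chiP _ (g ((r : R^c) *: a) 1)); last first.
  by apply/asboolP; exists ((r : R^c) *: a).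
by rewrite linearZ /= -[LHS]/(g a ((r : R) * 1)) mulr1.
Qed.

End CharacterModule.

(** * Injective hulls inside injective modules *)

Section SubmoduleAsModule.
Variables (K : nzRingType) (M : lmodType K).

(** The closure proof is a parameter of the type, so that the module structure
    can be inferred for a submodule that is only a local variable. *)
Record submodule_sort (G : {pred M}) (GS : GRing.submod_closed G) :=
  Submodule { submodule_val : M; _ : submodule_val \in G }.

Variables (G : {pred M}) (GS : GRing.submod_closed G).

HB.instance Definition _ := [isSub for @submodule_val G GS].
HB.instance Definition _ := [Choice of submodule_sort GS by <:].
HB.instance Definition _ := GRing.SubChoice_isSubLmodule.Build K M G
  (submodule_sort GS) (GRing.submod_closed_semi GS).

Lemma submodule_as_module :
  exists (W : lmodType K) (v : {linear W -> M}),
    injective v /\ forall x, x \in G <-> exists w, v w = x.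
Proof.
exists (submodule_sort GS : lmodType K), (val : {linear _ -> _}).
split; first exact: val_inj.
by move=> x; split=> [Gx|[w <-]]; [exists (Submodule GS Gx) | exact: valP].
Qed.

End SubmoduleAsModule.

Lemma lift_linear (K : nzRingType) (A W M : lmodType K)
    (v : {linear W -> M}) (f : {linear A -> M}) :
  injective v -> (forall a, exists w, v w = f a) ->
  exists h : {linear A -> W}, forall a, v (h a) = f a.
Proof.
move=> v_inj /choice[h hE].
have hL : linear h by move=> a x y; apply: v_inj; rewrite linearP !hE linearP.
pose mh := GRing.isLinear.Build _ _ _ _ h hL.
pose hl : {linear A -> W} := HB.pack h mh.
by exists hl.
Qed.

Lemma range_submod_closed (K : nzRingType) (A M : lmodType K)
    (f : {linear A -> M}) :
  GRing.submod_closed (mkpred (fun y => exists x, f x = y)).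
Proof.
split; first by apply/asboolP; exists 0; rewrite raddf0.
move=> a _ _ /asboolP[x <-] /asboolP[y <-]; apply/asboolP.
by exists (a *: x + y); rewrite linearP.
Qed.

(** Let [G] be a maximal essential extension of [j T] inside [I] and [C]
    maximal among the submodules with [C] and [G] independent.  Injectivity of
    [I] extends the projection [G + C -> G] to [psi : I -> I].  Maximality of
    [C] makes [psi I] essential over [G], so [psi I = G] by maximality of [G];
    thus [G] is a retract of [I], and inherits injectivity. *)
Lemma has_injective_hull (R : nzRingType) (T I : rmodType R)
    (j : {linear T -> I}) : injective_module I -> injective j ->
  exists (E : rmodType R) (e : {linear T -> E}), injective_hull e.
Proof.
move=> I_inj j_inj.
pose q x := x != 0 -> exists r, r *: x != 0 /\ exists t, j t = r *: x.
have [|G [GS jG Gq Gmax]] :=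
    maximal_submodule_within (q := q) (range_submod_closed j).
  by move=> _ /asboolP[t <-] jt; exists 1; rewrite scale1r; split=> //; exists t.
have [W [v [v_inj vP]]] := submodule_as_module GS.
have [||C [CS _ CG Cmax]] := @maximal_submodule_within _ I
    (fun x => x \in G -> x = 0) (pred1 0).
- by split=> [|a u w]; rewrite !inE // => /eqP-> /eqP->; rewrite scaler0 addr0.
- by move=> x /eqP.
have [V [c [c_inj cP]]] := submodule_as_module CS.
pose s (u : W * V) := v u.1 + c u.2.
have sL : linear s.
  by move=> a x y; rewrite /s /= !linearP scalerDr addrACA.
pose ms := GRing.isLinear.Build _ _ _ _ s sL.
pose sl : {linear (W * V)%type -> I} := HB.pack s ms.
have s_inj : injective sl.
  move=> [w1 c1] [w2 c2] /= /eqP; rewrite /s /= -subr_eq0 opprD addrACA -!raddfB.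
  rewrite addr_eq0 /= => /eqP wc.
  have w0 : v (w1 - w2) = 0.
    apply: CG; last by apply/vP; exists (w1 - w2).
    by rewrite wc; apply: submodN => //; apply/cP; exists (c1 - c2).
  have c0 : c (c1 - c2) = 0 by apply/eqP; rewrite -oppr_eq0 -wc w0.
  move/eqP: w0; rewrite raddf_eq0 // subr_eq0 => /eqP->.
  by move/eqP: c0; rewrite raddf_eq0 // subr_eq0 => /eqP->.
(* v and c embed G and C in I; the injective map s is (w, k) |-> w + k. *)
have [psi psiE] := I_inj _ _ sl (v \o fst : {linear (W * V)%type -> I}) s_inj.
have psiv w : psi (v w) = v w.
  by have := psiE (w, 0); rewrite /= /s /= raddf0 addr0.
have psic x : x \in C -> psi x = 0.
  by move=> /cP[k <-]; have := psiE (0, k); rewrite /= /s /= !raddf0 add0r.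
have psiG x : x \in G -> psi x = x by move=> /vP[w <-].
have rangeG x : psi x \in G.
  apply: (Gmax _ (range_submod_closed psi)); last by apply/asboolP; exists x.
    by move=> y Gy; apply/asboolP; exists y; rewrite psiG.
  move=> {x} _ /asboolP[x <-] psix0.
  (* psi x is non-zero, so x is outside C and C + xR meets G outside 0;
     psi fixes such a z = y + x r with y in C, and kills y. *)
  have [z [r [Gz z0 psiz]]] : exists z r, [/\ z \in G, z != 0 & z = r *: psi x].
    apply: contrapT => noz; move/eqP: psix0; apply; apply: (psic).
    apply: (Cmax _ (sum_with_line_closed x CS)).
    - exact: sub_sum_with_line.
    - move=> z /asboolP[y Cy [r zE]] Gz; apply: contrapT => /eqP z0.
      apply: noz; exists z, r; split=> //.
      by rewrite -(psiG z Gz) zE raddfD /= psic // add0r linearZ.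
    - exact: mem_sum_with_line.
  have [t [tz0 jt]] := Gq z Gz z0.
  by exists (t * r); rewrite -scalerA -psiz.
have [|rho rhoE] := lift_linear (f := psi) v_inj; first by move=> x; apply/vP.
have [|e eE] := lift_linear (f := j) v_inj.
  by move=> t; apply/vP/jG/asboolP; exists t.
exists W, e; split.
  move=> A B i g i_inj.
  have [h hE] := I_inj A B i (v \o g : {linear A -> I}) i_inj.
  exists (rho \o h : {linear B -> W}) => a /=.
  by apply: v_inj; rewrite rhoE -[h (i a)]/((h \o i) a) hE psiv.
split=> [x y exy|N NS [x Nx x0]]; first by apply: j_inj; rewrite -!eE exy.
have [||r [rx0 [t jt]]] := Gq (v x); first by apply/vP; exists x.
  by rewrite raddf_eq0.
have et : e t = r *: x by apply: v_inj; rewrite eE jt linearZ.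
exists t; rewrite et; first exact: submodZ.
by move: rx0; rewrite -linearZ /= raddf_eq0.
Qed.

(** * Right H-rings that are right max-rings *)

Lemma preimage_submod_closed (K : nzRingType) (A B : lmodType K)
    (f : {linear A -> B}) (N : {pred B}) :
  GRing.submod_closed N -> GRing.submod_closed [pred x | f x \in N].
Proof.
move=> [N0 NL]; split=> [|a x y]; rewrite !inE ?raddf0 // linearP.
exact: NL.
Qed.

Lemma linear_to_simple_surjective (R : nzRingType) (A S : rmodType R)
    (f : {linear A -> S}) x :
  simple_module S -> f x != 0 -> surjective_map f.
Proof.
move=> [_ Smin] fx0 y; have [f0|fS] := Smin _ (range_submod_closed f).
  by move: fx0; rewrite (f0 (f x)) ?eqxx //; apply/asboolP; exists x.
by have /asboolP := fS y.
Qed.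

(** The simple quotient [M / N], obtained as a submodule of the character
    module: it is the image of the transpose of a character of [M] that kills
    [N] but not [M]. *)
Lemma simple_quotient (R : nzRingType) (M : rmodType R) (N : {pred M}) :
  maximal_submodule N ->
  exists (T : rmodType R) (p : {linear M -> T})
         (j : {linear T -> character_module R}),
    [/\ simple_module T, injective j & exists x, p x != 0].
Proof.
move=> [NS [e eN] Nmax].
have [chi chiN chie] := separating_character (GRing.submod_closedB NS) eN.
have [h hE] := char_transpose chi.
have kerN x : h x = 0 <-> x \in N.
  split=> [hx0|Nx]; last first.
    by apply: eq_char => r; rewrite hE chiN //; apply: submodZ.
  (* The kernel of h contains N and misses e, so it is N by maximality. *)
  have [||kN|kT] := Nmax (mkpred (fun x => h x = 0)).
  - split=> [|a u w]; first by apply/asboolP; rewrite raddf0.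
    move=> /asboolP hu /asboolP hw; apply/asboolP.
    by rewrite linearP hu hw scaler0 addr0.
  - move=> y Ny; apply/asboolP/eq_char => r.
    by rewrite hE chiN //; apply: submodZ.
  - by apply: kN; apply/asboolP.
  - have /asboolP he0 := kT e.
    by move: chie; rewrite -[e]scale1r -hE he0 eqxx.
have [T [j [j_inj jP]]] := submodule_as_module (range_submod_closed h).
have [|p pE] := lift_linear (f := h) j_inj.
  by move=> x; apply/jP/asboolP; exists x.
have pe : p e != 0.
  apply/eqP => pe0; move/negP: eN; apply; apply/kerN.
  by rewrite -pE pe0 raddf0.
exists T, p, j; split; [split|by []|by exists e]; first by exists (p e).
move=> L LS.
have p_surj t : exists x, p x = t.
  have /jP/asboolP[x hx] : exists w, j w = j t by exists t.
  by exists x; apply: j_inj; rewrite pE.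
have [x Nx|LN|LT] := Nmax _ (preimage_submod_closed p LS).
- rewrite inE (_ : p x = 0); first by case: LS.
  by apply: j_inj; rewrite pE raddf0; apply/kerN.
- left=> t Lt; have [x xt] := p_surj t.
  have /LN/kerN hx : x \in [pred x | p x \in L] by rewrite inE xt.
  by apply: j_inj; rewrite -xt pE hx raddf0.
- by right=> t; have [x <-] := p_surj t; apply: LT.
Qed.

Lemma H_max_strongly_dual_Kasch (R : nzRingType) :
  right_H_ring R -> right_max_ring R -> right_strongly_dual_Kasch R.
Proof.
move=> HR maxR S E i Ssimple iE.
have [[s s0] _] := Ssimple; have [E_inj [i_inj _]] := iE.
have [|N /simple_quotient[T [p [j [Tsimple j_inj [x px0]]]]]] := maxR E.
  by exists (i s); rewrite raddf_eq0.
have [F [k kF]] := has_injective_hull (@injective_character_module R) j_inj.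
have [[f [g fK gK]]|nST] := pselect (isomorphic_modules S T).
  have gL : linear g.
    by move=> a u v; apply: (can_inj fK); rewrite linearP !gK.
  pose mg := GRing.isLinear.Build _ _ _ _ g gL.
  pose gl : {linear T -> S} := HB.pack g mg.
  exists (gl \o p : {linear E -> S}).
  apply: (linear_to_simple_surjective (x := x)) => //=.
  apply: contra px0 => /eqP gpx; apply/eqP; apply: (can_inj gK).
  by rewrite gpx; exact/esym/(raddf0 gl).
have [_ [k_inj _]] := kF.
have := HR S T E F i k Ssimple Tsimple nST iE kF (k \o p : {linear E -> F}) x.
by move=> /eqP; rewrite /= raddf_eq0 // (negPf px0).
Qed.

(** * Ideals of a commutative ring acting on projective modules *)

Section IdealAction.
Variables (K : comNzRingType) (I : {pred K^o}).
Hypothesis IS : GRing.submod_closed I.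

(** The submodule [M I], defined as the smallest submodule that contains all
    products; statements about it are then proved by exhibiting a submodule,
    without writing elements as sums. *)
Definition ideal_span (M : lmodType K) : {pred M} :=
  mkpred (fun x => forall N : {pred M}, GRing.submod_closed N ->
                     (forall a y, a \in I -> a *: y \in N) -> x \in N).

Local Arguments ideal_span M : clear implicits.

Lemma ideal_span_closed (M : lmodType K) : GRing.submod_closed (ideal_span M).
Proof.
split; first by apply/asboolP => N [].
move=> a x y /asboolP Ix /asboolP Iy; apply/asboolP => N NS IN.
by case: (NS) => _; apply; [apply: Ix | apply: Iy].
Qed.

Lemma mem_ideal_span (M : lmodType K) a (x : M) : a \in I -> a *: x \in ideal_span M.
Proof. by move=> Ia; apply/asboolP => N _; apply. Qed.

Lemma ideal_span_lift (A B : lmodType K) (f : {linear A -> B}) x :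
  surjective_map f -> x \in ideal_span B ->
  exists2 y, y \in ideal_span A & f y = x.
Proof.
move=> f_surj /asboolP xI.
suff /asboolP[y Iy <-] :
    x \in mkpred (fun x => exists2 y, y \in ideal_span A & f y = x) by exists y.
have [A0 AL] := ideal_span_closed A.
apply: xI => [|a y Ia].
  split; first by apply/asboolP; exists 0; rewrite ?raddf0.
  move=> a _ _ /asboolP[u Iu <-] /asboolP[v Iv <-]; apply/asboolP.
  by exists (a *: u + v); [apply: AL | rewrite linearP].
apply/asboolP; have [z <-] := f_surj y.
by exists (a *: z); [apply: mem_ideal_span | rewrite linearZ].
Qed.

Lemma functional_ideal_span (M : lmodType K) (f : {linear M -> K^o}) x :
  x \in ideal_span M -> f x \in I.
Proof.
move=> /asboolP/(_ [pred y | f y \in I]); apply.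
  exact: preimage_submod_closed.
move=> a y Ia; rewrite inE linearZ /= -[_ *: _]/(a * f y) mulrC.
exact: submodZ.
Qed.

Lemma prod_congruent (J : finType) (u w : J -> K) :
  (forall i, u i - w i \in I) -> \prod_i u i - \prod_i w i \in I.
Proof.
move=> uw; elim/big_rec2: _ => [|i y x _ xy]; first by rewrite subrr; case: IS.
have -> : u i * x - w i * y = u i *: (x - y : K^o) + y *: (u i - w i : K^o).
  rewrite -[RHS]/(u i * (x - y) + y * (u i - w i)) !mulrBr addrA.
  by rewrite [y * u i]mulrC [y * w i]mulrC addrNK.
by apply: submodD => //; apply: submodZ.
Qed.

Lemma det_congruent n (A B : 'M[K]_n) :
  (forall i j, A i j - B i j \in I) -> \det A - \det B \in I.
Proof.
move=> AB; rewrite -sumrB.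
apply: (big_ind (fun x => x \in I)) => [|x y Ix Iy|s _].
- by case: IS.
- exact: submodD.
by rewrite -mulrBr; apply: submodZ => //; apply: prod_congruent.
Qed.

(** The determinant trick: multiplying [(1 - A) v = 0] by the adjugate of
    [1 - A] gives [det (1 - A) v = 0], and [det (1 - A)] is congruent to
    [det 1 = 1] modulo [I]. *)
Lemma fixed_by_ideal_matrix n (A : 'M[K]_n) (v : 'cV[K]_n) :
  (forall i j, A i j \in I) -> A *m v = v ->
  exists2 a, a \in I & (1 - a) *: v = 0.
Proof.
move=> AI Av; exists (\det (1%:M : 'M[K]_n) - \det (1%:M - A)).
  by apply: det_congruent => i j; rewrite !mxE opprB addrC addrNK.
rewrite det1 opprB addrC addrNK -mul_scalar_mx -mul_adj_mx -mulmxA.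
by rewrite mulmxBl mul1mx Av subrr mulmx0.
Qed.

End IdealAction.

Arguments ideal_span {K} I M.

Lemma free_cover (K : comNzRingType) (P : lmodType K) :
  exists q : {linear {freeg P / K} -> P},
    surjective_map q /\ forall D, q D = \sum_(z <- dom D) coeff z D *: z.
Proof.
pose q0 : {freeg P / K} -> P := fglift (fun y => y).
pose mq := GRing.isZmodMorphism.Build _ _ q0 (lift_is_additive _).
pose q : {additive {freeg P / K} -> P} := HB.pack q0 mq.
have qU k (z : P) : q [freeg [:: (k, z)]] = k *: z by exact: liftU.
have qE D : q D = \sum_(z <- dom D) coeff z D *: z.
  by rewrite -{1}[D]freeg_sumE raddf_sum; apply: eq_bigr => z _; apply: qU.
have qZ : scalable q.
  move=> a D; rewrite [q D]qE scaler_sumr -{1}[D]freeg_sumE scaler_sumr raddf_sum.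
  apply: eq_bigr => z _; rewrite scalerA -qU; congr (q _).
  by apply/eqP/freeg_eqP => t; rewrite coeffZ !coeffU mulrA.
pose mz := GRing.isScalable.Build _ _ _ _ q qZ.
pose ql : {linear {freeg P / K} -> P} := HB.pack (q : _ -> _) mq mz.
exists ql; split=> // x; exists [freeg [:: (1, x)]].
by rewrite -[LHS]/(q _) qU scale1r.
Qed.

(** Let [s] be a section of the free cover of [P].  The coordinates of [s y]
    are linear in [y], so they take values in [I] because [P = P I].  If the
    elements [b i] carry the non-zero coordinates [v i] of [s x], then applying
    [s] to [x = sum v i b i] shows that [v] is fixed by the matrix of the
    coordinates of the [s (b j)], whose entries lie in [I]. *)
Lemma projective_ideal_span_annihilated (R : comNzRingType) (P : rmodType R)
    (I : {pred (R^c)^o}) :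
  GRing.submod_closed I -> projective_module P ->
  (forall x, x \in ideal_span I P) ->
  forall x : P, exists2 a, a \in I & (1 - a) *: x = 0.
Proof.
move=> IS P_proj PI x; pose K : comNzRingType := R^c.
have [q [q_surj qE]] := @free_cover K P.
have [s sK] := P_proj _ _ q (idfun : {linear P -> P}) q_surj.
have coefI z y : coeff z (s y) \in I.
  have cL : linear (coeff z : {freeg P / K} -> K^o).
    by move=> a u v; rewrite raddfD /= coeffZ.
  pose mc := GRing.isLinear.Build _ _ _ _ (coeff z : {freeg P / K} -> K^o) cL.
  pose c : {linear {freeg P / K} -> K^o} :=
    HB.pack (coeff z : {freeg P / K} -> K^o) mc.
  exact: (functional_ideal_span IS (c \o s : {linear P -> K^o})).
have [n [b xE]] : exists n (b : n.-tuple P),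
    x = \sum_i coeff (tnth b i) (s x) *: tnth b i.
  exists (size (dom (s x))), (in_tuple (dom (s x))).
  by rewrite -{1}[x]/(idfun x) -sK /= qE [in LHS]big_tnth.
pose A := \matrix_(i, j) coeff (tnth b i) (s (tnth b j)).
pose v := \col_i coeff (tnth b i) (s x).
have [||a Ia av] := @fixed_by_ideal_matrix K I IS _ A v.
- by move=> i j; rewrite mxE.
- apply/colP => i; rewrite !mxE [in RHS]xE !raddf_sum /=; apply: eq_bigr => j _.
  by rewrite !mxE linearZ /= coeffZ mulrC.
exists a => //; rewrite [in LHS]xE scaler_sumr big1 // => i _.
have /colP/(_ i) := av; rewrite !mxE => avi.
by rewrite scalerA avi scale0r.
Qed.

(** * Commutative perfect rings *)

Section Annihilator.
Variables (R : comNzRingType) (S : rmodType R) (s : S).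

Definition annihilator : {pred (R^c)^o} :=
  mkpred (fun a : (R^c)^o => a *: s = 0).

Lemma annihilator_closed : GRing.submod_closed annihilator.
Proof.
split; first by apply/asboolP; rewrite scale0r.
move=> a u v /asboolP us /asboolP vs; apply/asboolP.
by rewrite scalerDl -scalerA us vs scaler0 addr0.
Qed.

Hypothesis Ssimple : simple_module S.

(** The cyclic module generated by [s] is [R] modulo the annihilator; for
    simple [S] that quotient is a field. *)
Lemma inverse_mod_annihilator (a : R^c) :
  a \notin annihilator -> exists b, 1 - b * a \in annihilator.
Proof.
move=> ma; pose f (b : (R^c)^o) := b *: (a *: s).
have fL : linear f by move=> c u v; rewrite /f scalerDl -scalerA.
pose mf := GRing.isLinear.Build _ _ _ _ f fL.
pose fl : {linear (R^c)^o -> S} := HB.pack f mf.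
have [|b bE] := @linear_to_simple_surjective R _ _ fl 1 Ssimple _ s.
  by rewrite /= /f scale1r; apply: contra ma => /eqP as0; apply/asboolP.
by exists b; apply/asboolP; rewrite scalerBl scale1r -scalerA [b *: _]bE subrr.
Qed.

(** Send [M m] to [0] and [e] to [s], where [m] is the annihilator of [s].
    The map vanishes on [M m], and [M / M m] and [S] are vector spaces over the
    field [R / m], so a partial map extends to any further [b]: either [b] is already
    in the domain, or only the multiples of [b] by [m] are, and these are sent
    to [0]. *)
Lemma linear_to_simple_extending (M : rmodType R) e :
  e \notin ideal_span annihilator M -> exists h : {linear M -> S}, h e = s.
Proof.
move=> eN; set m := annihilator; have mS := annihilator_closed.
pose N := ideal_span m M; have NS : GRing.submod_closed N.
  exact: ideal_span_closed.
have Nm a x : a \in m -> a *: x \in N by exact: mem_ideal_span.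
pose G0 : {pred M * S} := mkpred (fun u : M * S =>
  exists2 y, y \in N & exists a, u = (y + a *: e, a *: s)).
have [||G GS sG Gf b|h hP] := @extend_partial_linear _ M S G0.
- split.
    apply/asboolP; exists 0; first by case: NS.
    by exists 0; rewrite !scale0r addr0.
  move=> c _ _ /asboolP[y Ny [a ->]] /asboolP[z Nz [b ->]]; apply/asboolP.
  exists (c *: y + z); first by case: NS => _; apply.
  by exists (c * a + b); rewrite !scalerDl -!scalerA -addrACA -scalerDr.
- move=> t /asboolP[y Ny [a [/esym/eqP]]]; rewrite addr_eq0 => /eqP yE ->.
  apply: contrapT => as0; have /inverse_mod_annihilator[b bm] : a \notin m.
    by apply/negP => /asboolP.
  move/negP: eN; apply.
  have -> : e = (1 - b * a) *: e + b *: (a *: e).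
    by rewrite scalerA -scalerDl addrNK scale1r.
  apply: submodD => //; first exact: Nm.
  apply: submodZ => //; rewrite -[a *: e]opprK -yE; exact: submodN.
- have [[d Gd]|nodom] := pselect (exists d, (b, d) \in G).
    exists d => a y Gy; apply/eqP; rewrite -subr_eq0; apply/eqP/Gf.
    have -> : (0, y - a *: d) = (a *: b, y) - a *: (b, d) :> M * S.
      by congr pair; rewrite -[RHS]/(a *: b - a *: b) subrr.
    by apply: submodB => //; apply: submodZ.
  have NG x : x \in N -> (x, 0) \in G.
    move=> Nx; apply: sG; apply/asboolP; exists x => //.
    by exists 0; rewrite !scale0r addr0.
  exists 0 => a y Gy; rewrite scaler0.
  have [am|/inverse_mod_annihilator[c cm]] := boolP (a \in m).
    apply: Gf; have -> : (0, y) = (a *: b, y) - (a *: b, 0) :> M * S.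
      congr pair; last by rewrite -[RHS]/(y - 0) subr0.
      by rewrite -[RHS]/(a *: b - a *: b) subrr.
    by apply: submodB => //; apply/NG/Nm.
  case: nodom; exists (c *: y).
  have -> : (b, c *: y) = ((1 - c * a) *: b, 0) + c *: (a *: b, y) :> M * S.
    congr pair; last by rewrite -[RHS]/(0 + c *: y) add0r.
    rewrite -[RHS]/((1 - c * a) *: b + c *: (a *: b)) scalerA -scalerDl.
    by rewrite addrNK scale1r.
  by apply: submodD => //; [apply/NG/Nm | apply: submodZ].
exists h; apply: hP; apply/asboolP; exists 0; first by case: NS.
by exists 1; rewrite !scale1r add0r.
Qed.

End Annihilator.

Lemma perfect_strongly_dual_Kasch (R : comNzRingType) :
  perfect_comring R -> strongly_dual_Kasch R.
Proof.
move=> perfR S E i Ssimple [_ [i_inj _]].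
have [[s s0] _] := Ssimple; have mS := annihilator_closed s.
have [e eN] : exists e, e \notin ideal_span (annihilator s) E.
  apply: contrapT => noe.
  have EI x : x \in ideal_span (annihilator s) E.
    by apply: contrapT => /negP xN; apply: noe; exists x.
  have [P [p [P_proj p_surj p_small]]] := perfR E.
  have PI x : x \in ideal_span (annihilator s) P.
    apply: p_small; first exact: ideal_span_closed.
    move=> y; have [z Iz pz] := ideal_span_lift p_surj (EI (p y)).
    exists z, (y - z); split=> //; last by rewrite addrC addrNK.
    by rewrite inE raddfB /= pz subrr.
  have [x xE] := p_surj (i s).
  have [a /asboolP as0 ax] := projective_ideal_span_annihilated mS P_proj PI x.
  have is0 : i s = 0.
    rewrite -[i s]scale1r -[1](addrNK a) scalerDl -{1}xE -linearZ /= ax raddf0.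
    by rewrite add0r -linearZ /= as0 raddf0.
  by move/eqP: is0; rewrite raddf_eq0 // (negPf s0).
have [h he] := linear_to_simple_extending Ssimple eN.
by exists h; apply: (linear_to_simple_surjective (x := e)); rewrite ?he.
Qed.

Theorem proposition2p8 :
  (forall R : nzRingType,
     right_H_ring R -> right_max_ring R -> right_strongly_dual_Kasch R) /\
  (forall R : comNzRingType,
     perfect_comring R -> strongly_dual_Kasch R).
Proof.
split; [exact: H_max_strongly_dual_Kasch | exact: perfect_strongly_dual_Kasch].
Qed.
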